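(* There is a b-metric space that is not an $\mathcal{F}$-metric space; that is, there exist a nonempty set $X$ and a b-metric $d$ on $X$ such that $d$ is not an $\mathcal{F}$-metric on $X$.
   Context: $\mathbb{N}=\{0,1,2,\dots\}$. Let $\mathcal{F}$ be the set of functions $f:(0,+\infty)\to\mathbb{R}$ such that: $(\mathcal{F}_1)$ $f$ is non-decreasing, i.e. $0<s<t$ implies $f(s)\le f(t)$; $(\mathcal{F}_2)$ for every sequence $\{t_n\}\subset(0,+\infty)$, $\lim_{n\to+\infty}t_n=0$ if and only if $\lim_{n\to+\infty}f(t_n)=-\infty$. Let $X$ be a nonempty set and $D:X\times X\to[0,+\infty)$. $D$ is an $\mathcal{F}$-metric on $X$, and $(X,D)$ is an $\mathcal{F}$-metric space, if there exists $(f,\alpha)\in\mathcal{F}\times[0,+\infty)$ such that: (D1) for all $(x,y)\in X\times X$, $D(x,y)=0$ if and only if $x=y$; (D2) $D(x,y)=D(y,x)$ for all $(x,y)\in X\times X$; (D3) for every $(x,y)\in X\times X$, every $N\in\mathbb{N}$ with $N\ge2$, and every $(u_i)_{i=1}^N\subset X$ with $(u_1,u_N)=(x,y)$, if $D(x,y)>0$ then $f(D(x,y))\le f\left(\sum_{i=1}^{N-1}D(u_i,u_{i+1})\right)+\alpha$. A mapping $d:X\times X\to[0,+\infty)$ is a b-metric on $X$ (and $(X,d)$ is a b-metric space) if it satisfies (D1), (D2), and there exists $K\ge1$ such that $d(x,y)\le K\left(d(x,z)+d(z,y)\right)$ for all $(x,y,z)\in X\times X\times X$. *)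

(* Defs.v *)
From mathcomp Require Import all_boot all_order all_algebra.
From mathcomp Require Import all_classical all_reals all_analysis.
Import Order.TTheory GRing.Theory Num.Theory.
Import numFieldNormedType.Exports.

Set Implicit Arguments.
Unset Strict Implicit.
Unset Printing Implicit Defensive.

Local Open Scope classical_set_scope.
Local Open Scope ring_scope.

(* The class F of functions (0, +oo) -> R.  A function on (0, +oo) is
   represented by a total f : R -> R of which only the values at positive
   arguments are constrained. *)
Definition F_nondecreasing (R : realType) (f : R -> R) : Prop :=
  forall s t : R, 0 < s -> s < t -> f s <= f t.

Definition F_limit (R : realType) (f : R -> R) : Prop :=
  forall t : nat -> R, (forall n, 0 < t n) ->
    (t n @[n --> \oo] --> (0 : R)) <-> (f (t n) @[n --> \oo] --> -oo).

Definition in_F (R : realType) (f : R -> R) : Prop :=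
  F_nondecreasing f /\ F_limit f.

Definition nonneg_valued (R : realType) (X : Type) (D : X -> X -> R) : Prop :=
  forall x y, 0 <= D x y.

Definition separates_points (R : realType) (X : Type) (D : X -> X -> R) : Prop :=
  forall x y, D x y = 0 <-> x = y.

Definition symmetric_dist (R : realType) (X : Type) (D : X -> X -> R) : Prop :=
  forall x y, D x y = D y x.

(* A finite family (u_i) with 1 <= i <= N is given by u : nat -> X, of which
   only the values at 1, ..., N matter.  Under separation and 0 < D x y the
   sum is positive, so f is never used outside (0, +oo). *)
Definition F_chain_ineq (R : realType) (X : Type) (D : X -> X -> R)
    (f : R -> R) (alpha : R) : Prop :=
  forall (x y : X) (N : nat) (u : nat -> X),
    (2 <= N)%N -> u 1%N = x -> u N = y -> 0 < D x y ->
    f (D x y) <= f (\sum_(1 <= i < N) D (u i) (u i.+1)) + alpha.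

Definition F_metric (R : realType) (X : Type) (D : X -> X -> R) : Prop :=
  nonneg_valued D /\
  exists (f : R -> R) (alpha : R),
    [/\ in_F f, 0 <= alpha, separates_points D, symmetric_dist D
      & F_chain_ineq D f alpha].

Definition b_metric (R : realType) (X : Type) (d : X -> X -> R) : Prop :=
  [/\ nonneg_valued d, separates_points d, symmetric_dist d
    & exists K : R, 1 <= K /\ forall x y z, d x y <= K * (d x z + d z y)].

(* Main.v *)
Require Import Defs.
From mathcomp Require Import all_boot all_order all_algebra.
From mathcomp Require Import all_classical all_reals all_analysis.
From mathcomp Require Import ring lra.
Import GRing.Theory Num.Theory.

(** On the real line [(x - y)^2] is a b-metric with constant 2.  Cutting
    [[0, 1]] into [n + 1] equal steps gives a chain of total length
    [1 / (n + 1)], so (D3) would bound [f (1 / (n + 1))] below by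
    [f 1 - alpha], whereas it tends to [-oo]. *)

Local Open Scope ring_scope.

Definition sqr_dist (R : realType) (x y : R) : R := (x - y) ^+ 2.

Lemma sqr_dist_b_metric (R : realType) : b_metric (sqr_dist R).
Proof.
split.
- by move=> x y; exact: sqr_ge0.
- move=> x y; rewrite /sqr_dist; split=> [/eqP|->]; last by rewrite subrr expr0n.
  by rewrite sqrf_eq0 subr_eq0 => /eqP.
- by move=> x y; rewrite /sqr_dist -sqrrN opprB.
- exists 2; split=> [|x y z]; first by rewrite ler1n.
  (* With [a = x - z] and [b = z - y], [2 (a^2 + b^2) - (a + b)^2 = (a - b)^2]. *)
  rewrite /sqr_dist; have := sqr_ge0 (x - z - (z - y)); nra.
Qed.

(** Each of the [n + 1] steps contributes [1 / (n + 1)^2]. The predecessors appear because chains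
    are indexed from 1, so the first point is 0. *)
Lemma sqr_dist_chain_sum (R : realType) (n : nat) :
  \sum_(1 <= i < n.+2)
    sqr_dist R (i.-1%:R / n.+1%:R) (i.+1.-1%:R / n.+1%:R) = n.+1%:R^-1.
Proof.
rewrite big_add1 /= (eq_bigr (fun=> n.+1%:R^-1 ^+ 2)).
  rewrite sumr_const_nat subn0 -mulr_natl; field.
  by rewrite (addrC 1) natr1 pnatr_eq0.
by move=> i _; rewrite /sqr_dist -natr1; ring.
Qed.

Lemma sqr_dist_not_F_metric (R : realType) : ~ F_metric (sqr_dist R).
Proof.
move=> [_ [f [alpha [[_ f_lim] _ _ _ chain]]]].
(* [harmonic n] is [1 / (n + 1)], the chain length, so some [n] gives
   [f (harmonic n) < f 1 - alpha]. *)
have /(f_lim harmonic (@harmonic_gt0 R))/cvgrNyPlt/(_ (f 1 - alpha)) :=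
  @cvg_harmonic R.
move=> [n _ /(_ n (leqnn n)) /=].
have := chain 0 1 n.+2 (fun i => i.-1%:R / n.+1%:R) isT.
rewrite /= mul0r divff ?pnatr_eq0// sqr_dist_chain_sum.
rewrite {1 2}/sqr_dist sub0r sqrrN expr1n => /(_ erefl erefl ltr01).
by rewrite /harmonic /=; lra.
Qed.

Theorem proposition2p1 (R : realType) :
  exists (X : Type) (d : X -> X -> R),
    inhabited X /\ b_metric d /\ ~ F_metric d.
Proof.
exists R, (sqr_dist R); split; first exact: (inhabits 0).
by split; [exact: sqr_dist_b_metric | exact: sqr_dist_not_F_metric].
Qed.
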